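(* For all integers $p\geq 17$ and $k\geq \left\lfloor \sqrt{p-1}\right\rfloor-1$, we have $$g^k_{\left\lfloor \sqrt{p-1}\right\rfloor-1}(p)\geq k^2+2k+2.$$
   Context: A Gallai-$k$-coloring of the complete graph $K_n$ is a map $c:E(K_n)\to\{1,\dots,k\}$ (not necessarily surjective) with no rainbow triangle, i.e. every triangle receives at most two distinct colors. For integers $k\ge 1$ and $1\le q\le \binom{p}{2}$, $g^k_q(p)$ denotes the smallest positive integer $n$ such that every Gallai-$k$-coloring of $K_n$ contains a copy of $K_p$ whose edges receive at most $q$ distinct colors. *)

(* Defs.v *)
From mathcomp Require Import all_boot zify.

Set Implicit Arguments.
Unset Strict Implicit.
Unset Printing Implicit Defensive.

Definition edges (V : finType) (A : {set V}) : {set {set V}} :=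
  [set e : {set V} | (e \subset A) && (#|e| == 2)].

(* A k-coloring of E(K_n) is represented by a map on all subsets of the
   vertex set; only its values on two-element subsets are ever used. *)
Definition coloring (n k : nat) := {ffun {set 'I_n} -> 'I_k}.

Definition colors (V : finType) (k : nat) (c : {ffun {set V} -> 'I_k})
  (A : {set V}) : {set 'I_k} := c @: edges A.

Definition gallai (n k : nat) (c : coloring n k) : bool :=
  [forall T : {set 'I_n}, (#|T| == 3) ==> (#|colors c T| <= 2)].

Definition has_clique (n k q p : nat) (c : coloring n k) : bool :=
  [exists A : {set 'I_n}, (#|A| == p) && (#|colors c A| <= q)].

Definition gallai_arrow (k q p n : nat) : bool :=
  (0 < n) && [forall c : coloring n k, gallai c ==> has_clique q p c].

Fixpoint ramsey_bound (k s : nat) : nat :=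
  if s is s'.+1 then (k * ramsey_bound k s').+1 else 0.

Lemma ramsey_mono (V : finType) (k : nat) (c : {ffun {set V} -> 'I_k})
    (s : nat) (f : 'I_k -> nat) (A : {set V}) :
  \sum_i f i <= s -> ramsey_bound k s <= #|A| ->
  exists i (B : {set V}), [/\ B \subset A, #|B| = f i & colors c B \subset [set i]].
Proof.
have k0 : 'I_k := c set0.
elim: s f A => [|s IHs] f A sum_f leA.
  exists k0, set0; rewrite sub0set cards0; split=> //.
    by move: sum_f; rewrite (bigD1 k0) //=; lia.
  apply/subsetP=> j /imsetP[e]; rewrite inE subset0 => /andP[/eqP-> ].
  by rewrite cards0.
have [i /eqP fi0|f_gt0] := pickP (fun i => f i == 0).
  exists i, set0; rewrite sub0set cards0 fi0; split=> //.
  apply/subsetP=> j /imsetP[e]; rewrite inE subset0 => /andP[/eqP-> ].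
  by rewrite cards0.
have /card_gt0P[v vA] : 0 < #|A| by move: leA => /=; lia.
pose N i := [set w in A :\ v | c [set v; w] == i].
have [i leN|ltN] := pickP (fun i => ramsey_bound k s <= #|N i|); last first.
  have cardA : #|A :\ v| = \sum_i #|N i|.
    rewrite -sum1_card (partition_big (fun w => c [set v; w]) xpredT) //=.
    apply: eq_bigr => i _; rewrite -sum1_card.
    by apply: eq_bigl => w; rewrite !inE.
  have : \sum_i (#|N i|).+1 <= \sum_(i < k) ramsey_bound k s.
    by apply: leq_sum => i _; move: (ltN i) => /=; lia.
  under eq_bigr do rewrite -addn1.
  rewrite big_split /= -cardA !sum_nat_const card_ord.
  have := cardsD1 v A; rewrite vA; move: leA (ltn_ord k0) => /=; lia.
pose f' j := if j == i then (f i).-1 else f j.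
have sum_f' : \sum_j f' j <= s.
  move: sum_f; rewrite (bigD1 i) //= [X in _ -> X <= _](bigD1 i) //= /f' eqxx.
  rewrite [X in _ -> _ + X <= _](eq_bigr f) => [|j /negPf-> //].
  by move: (f_gt0 i) => /=; lia.
have [j [B [sBN cardB colB]]] := IHs f' (N i) sum_f' leN.
have sBA : B \subset A.
  by apply: subset_trans sBN _; apply/subsetP=> w; rewrite !inE => /andP[/andP[]].
have [eji|nji] := eqVneq j i; last first.
  by exists j, B; move: cardB; rewrite /f' (negPf nji).
move: cardB colB; rewrite /f' eji eqxx => cardB colB.
have vB : v \notin B.
  by apply/negP=> /(subsetP sBN); rewrite !inE eqxx.
exists i, (v |: B); split.
- by rewrite subUset sub1set vA.
- by rewrite cardsU1 vB cardB; move: (f_gt0 i) => /=; lia.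
apply/subsetP=> _ /imsetP[e + ->]; rewrite inE => /andP[seB /cards2P[x [y [nxy def_e]]]].
have [ve|vNe] := boolP (v \in e); last first.
  apply: (subsetP colB); apply: imset_f; rewrite inE def_e cards2 nxy andbT -def_e.
  apply/subsetP=> w we; have := subsetP seB _ we.
  by rewrite !inE => /orP[/eqP wv|//]; rewrite -wv we in vNe.
have [w [wv {}def_e]] : exists w, w != v /\ e = [set v; w].
  move: ve; rewrite def_e !inE => /orP[]/eqP->; first by exists y; rewrite eq_sym.
  by exists x; rewrite setUC.
have : w \in v |: B by apply: (subsetP seB); rewrite def_e !inE eqxx orbT.
rewrite !inE (negPf wv) /= => /(subsetP sBN).
by rewrite !inE def_e => /andP[].
Qed.

Lemma gallai_arrow_ex (k q p : nat) : exists n, gallai_arrow k q.+1 p n.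
Proof.
pose s := \sum_(i < k) p.
exists (ramsey_bound k s).+1; apply/andP; split=> //.
apply/forallP=> c; apply/implyP=> _; apply/existsP.
have [|i [B [_ cardB colB]]] :=
  @ramsey_mono _ k c s (fun=> p) [set: 'I_(ramsey_bound k s).+1] (leqnn _).
  by rewrite cardsT card_ord.
exists B; rewrite cardB eqxx /=.
by apply: leq_trans (subset_leq_card colB) _; rewrite cards1.
Qed.

(* g^k_q(p). For q = 0 (outside the intended range 1 <= q <= 'C(p, 2)) no n
   need exist; the value 0 there is a dummy. *)
Definition gallai_ramsey (k q p : nat) : nat :=
  if q is q'.+1 then ex_minn (gallai_arrow_ex k q' p) else 0.

Lemma gallai_ramseyP (k q p : nat) : 0 < q ->
  gallai_arrow k q p (gallai_ramsey k q p) /\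
  forall n, gallai_arrow k q p n -> gallai_ramsey k q p <= n.
Proof. by case: q => // q _; rewrite /gallai_ramsey; case: ex_minnP. Qed.

(* Main.v *)
Require Import Defs.
From mathcomp Require Import all_boot zify.

(** The bound is witnessed by one colouring of the naturals below
    [(k + 1) ^ 2], which controls the cliques for every number of colours at
    once: if [S] is the set of colours of the edges inside [A], then
    [#|A| <= #|S|.+1 ^ 2] ([layered_clique]).

    Cut the naturals into layers [j ^ 2, (j + 1) ^ 2), the [j]-th having
    [2 * j + 1] members, and cut the layer [j] into levels, the first member
    alone at level 0 and then two members at each level [1, ..., j].  For
    [u < v], colour the edge [uv] by the layer of [v] if [u] lies in another
    layer, and by the level of [v] otherwise.  Below [(k + 1) ^ 2] only the
    colours [1, ..., k] occur.  In a triangle [u < v < w], two edges agree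
    ([edge_color_triangle]), so this is a Gallai colouring.

    For the clique bound, let [r x] count the colours of [S] among
    [1, ..., x], and move every vertex of [A] to the layer and level given by
    the [r]-images of its own ([compress]).  This is strictly increasing on
    [A] ([compress_mono]): whenever [u < v] are in [A] in different layers, or
    in one layer but on different levels, the layer or level of [v] is the
    colour of [uv], a member of [S], so [r] jumps there; and a level with both
    members in [A] is itself a colour of [S], so it is not sent to level 0,
    which has room for one vertex only.  As [r x <= #|S|], the image lies in
    the layers [0, ..., #|S|], which have [#|S|.+1 ^ 2] members.

    Finally, if [q + 1] is the integer square root of [p - 1], then
    [p > (q + 1) ^ 2], so no [p]-clique of this colouring has at most [q]
    colours, for any number of vertices up to [(k + 1) ^ 2]. *)

Set Implicit Arguments.
Unset Strict Implicit.
Unset Printing Implicit Defensive.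

(** * Layers, levels and the colour of a pair *)

Definition layer (v : nat) : nat := Nat.sqrt v.

Definition offset (v : nat) : nat := v - layer v ^ 2.

Definition level (v : nat) : nat := uphalf (offset v).

Definition edge_color (u v : nat) : nat :=
  if layer u == layer v then level v else layer v.

Lemma layer_bounds v : layer v ^ 2 <= v < (layer v).+1 ^ 2.
Proof.
rewrite /layer; have := PeanoNat.Nat.sqrt_specif v.
by rewrite -!mulnn; lia.
Qed.

Lemma layer_mono u v : u <= v -> layer u <= layer v.
Proof. by move=> uv; apply/leP/PeanoNat.Nat.sqrt_le_mono/leP. Qed.

Lemma offset_le v : offset v <= (layer v).*2.
Proof. by have := layer_bounds v; rewrite /offset -!mulnn; lia. Qed.

Lemma offsetK v : layer v ^ 2 + offset v = v.
Proof. by have := layer_bounds v; rewrite /offset -!mulnn; lia. Qed.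

Lemma level_le_layer v : level v <= layer v.
Proof. by have := offset_le v; rewrite /level; lia. Qed.

Lemma offset_level v : offset v = (level v).*2 - odd (offset v).
Proof. by rewrite /level; lia. Qed.

Lemma edge_color_gt0 u v : u < v -> 0 < edge_color u v.
Proof.
move=> uv; rewrite /edge_color; have := layer_mono (ltnW uv).
case: eqP => [e _|]; last by lia.
by have := offsetK u; have := offsetK v; rewrite /level e; lia.
Qed.

Lemma edge_color_le_layer u v : edge_color u v <= layer v.
Proof. by rewrite /edge_color; case: eqP => // _; apply: level_le_layer. Qed.

(** If [v] lies in the layer of [w] and [u] does not, then [v] and [w] look the
    same from [u]; in all other cases [u] and [v] look the same from [w]. *)
Lemma edge_color_triangle u v w : u < v -> v < w ->
  edge_color u w = edge_color v w \/ edge_color u v = edge_color u w.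
Proof.
move=> uv vw; rewrite /edge_color.
have := layer_mono (ltnW uv); have := layer_mono (ltnW vw) => luv lvw.
case: (eqVneq (layer v) (layer w)) => [<-|vNw]; last first.
  by left; rewrite ifN //; lia.
by case: eqP => [_|_]; [left | right].
Qed.

(** * Compression of a clique onto few layers *)

(** With [r] the rank in the colour set of a clique, the truncated subtraction
    merges the two members of a level sent to 0; that level is then not a
    colour, so the clique contains at most one of them. *)
Definition compress (r : nat -> nat) (v : nat) : nat :=
  r (layer v) ^ 2 + ((r (level v)).*2 - odd (offset v)).

Lemma compress_lt (r : nat -> nat) (v : nat) :
  {homo r : x y / x <= y} -> compress r v < (r (layer v)).+1 ^ 2.
Proof.
move=> r_mono; have := r_mono _ _ (level_le_layer v).
by rewrite /compress -!mulnn; move: (r _) (r _) => a b; nia.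
Qed.

(** The colour of [uv] is the layer or level of [v] at which [u] and [v] are
    separated, so a jump of [r] at that one value keeps them in order. *)
Lemma compress_mono (r : nat -> nat) (u v : nat) :
    {homo r : x y / x <= y} -> u < v ->
    (forall x, x < edge_color u v -> r x < r (edge_color u v)) ->
  compress r u < compress r v.
Proof.
move=> r_mono uv jump; have := layer_mono (ltnW uv).
move: jump; rewrite /edge_color; case: eqP => [e|/eqP ne] jump luv; last first.
  have lt_layer : r (layer u) < r (layer v) by apply: jump; lia.
  apply: leq_trans (leq_trans _ (leq_addr _ _)); first exact: compress_lt.
  by rewrite leq_exp2r.
rewrite /compress e ltn_add2l.
have lt_offset : offset u < offset v.
  by have := offsetK u; have := offsetK v; rewrite e; lia.
have := offset_level u; have := offset_level v.
have [lt_level|ge_level] := ltnP (level u) (level v).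
  by have := jump _ lt_level; lia.
(* On a common level [u] is the odd member; the jump of [r] makes the level
   positive after compression, so the subtraction of 1 is not truncated. *)
have := jump 0; rewrite /level in lt_offset ge_level *.
have -> : uphalf (offset u) = uphalf (offset v) by lia.
by move: (r 0) (r _) => a b; lia.
Qed.

(** * The colouring of the complete graph *)

(** The same colour as [edge_color], read off an unordered pair: its larger
    member is a maximum, and the smaller one only matters through whether both
    have the same layer. *)
Definition pair_color n (e : {set 'I_n}) : nat :=
  let v := \max_(x in e) (x : nat) in
  if [forall x in e, layer x == layer v] then level v else layer v.

(** The colour [c.+1] becomes the index [c]. *)
Definition layered_coloring n k : coloring n k.+1 :=
  [ffun e => inord (pair_color e).-1].

Lemma pair_colorE n (u v : 'I_n) : u < v ->
  pair_color [set u; v] = edge_color u v.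
Proof.
move=> uv; rewrite /pair_color /edge_color.
have uNv : u \notin [set v] by rewrite inE neq_ltn uv.
rewrite big_setU1 //= big_set1 (maxn_idPr (ltnW uv)).
congr (if _ then _ else _); apply/forall_inP/eqP => [layer_eq|layer_eq x].
  by apply/eqP/layer_eq; rewrite !inE eqxx.
by rewrite !inE => /orP[]/eqP-> //; rewrite layer_eq.
Qed.

Lemma layered_coloringE n k (u v : 'I_n) : u < v ->
  layered_coloring n k [set u; v] = inord (edge_color u v).-1.
Proof. by move=> uv; rewrite ffunE pair_colorE. Qed.

Lemma cards2_lt n (A : {set 'I_n}) : #|A| = 2 ->
  exists u v : 'I_n, u < v /\ A = [set u; v].
Proof.
move=> /eqP/cards2P[x [y [xNy ->]]].
move: xNy; rewrite neq_ltn => /orP[xy|yx]; first by exists x, y.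
by exists y, x; rewrite setUC.
Qed.

Lemma cards3_lt n (A : {set 'I_n}) : #|A| = 3 ->
  exists u v w : 'I_n, [/\ u < v, v < w & A = [set u; v; w]].
Proof.
move=> A3; have /card_gt0P[x0 x0A] : 0 < #|A| by rewrite A3.
have [u uA u_min] := @arg_minnP _ x0 (mem A) val x0A; rewrite /= in uA u_min.
have /cards2_lt[v [w [vw Au]]] : #|A :\ u| = 2.
  by have := cardsD1 u A; rewrite uA; lia.
exists u, v, w; split=> //; last by rewrite -setUA -Au setD1K.
have /setD1P[vNu /u_min uv] : v \in A :\ u by rewrite Au !inE eqxx.
by rewrite ltn_neqAle uv eq_sym vNu.
Qed.

Lemma layered_gallai n k : gallai (layered_coloring n k).
Proof.
apply/forallP=> T; apply/implyP=> /eqP/cards3_lt[u [v [w [uv vw ->]]]].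
have uw := ltn_trans uv vw.
set c := layered_coloring n k.
have triangle_colors :
    colors c [set u; v; w] \subset [set c [set u; v]; c [set v; w]; c [set u; w]].
  apply/subsetP=> _ /imsetP[e + ->]; rewrite inE => /andP[/subsetP eT /eqP/cards2_lt].
  case=> x [y [xy e_xy]]; move: eT; rewrite e_xy => eT.
  have /eT : x \in [set x; y] by rewrite !inE eqxx.
  have /eT : y \in [set x; y] by rewrite !inE eqxx orbT.
  rewrite !inE -!orbA => /or3P[]/eqP ey /or3P[]/eqP ex; subst x y;
    rewrite ?eqxx ?orbT //; lia.
apply: leq_trans (subset_leq_card triangle_colors) _.
rewrite /c !layered_coloringE //.
case: (edge_color_triangle uv vw) => ->.
- by rewrite -setUA setUid cards2; case: eqP.
- by rewrite setUAC setUid cards2; case: eqP.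
Qed.

(** * Cliques *)

(** Membership of the colour [x] in [S] shows as a jump of [rank S] at [x]
    itself, because the index of the colour [x] is [x.-1]. *)
Definition rank k (S : {set 'I_k}) (x : nat) : nat := #|[set i in S | i < x]|.

Lemma rank_mono k (S : {set 'I_k}) : {homo rank S : x y / x <= y}.
Proof.
move=> x y xy; apply/subset_leq_card/subsetP=> i; rewrite !inE.
by case/andP=> -> ix; apply: leq_trans xy.
Qed.

Lemma rank_le k (S : {set 'I_k}) x : rank S x <= #|S|.
Proof. by apply/subset_leq_card/subsetP=> i; rewrite inE => /andP[]. Qed.

Lemma rank_jump k (S : {set 'I_k}) (i : 'I_k) x :
  i \in S -> x <= i -> rank S x < rank S i.+1.
Proof.
move=> iS xi; apply: proper_card; apply/properP; split.
  by apply/subsetP=> j; rewrite !inE => /andP[-> jx] /=; lia.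
by exists i; rewrite !inE iS //=; lia.
Qed.

(** The layers [0, ..., k.+1] hold exactly the naturals below [k.+2 ^ 2]; beyond
    them [inord] would identify colours. *)
Lemma layered_clique n k (A : {set 'I_n}) : n <= k.+2 ^ 2 ->
  #|A| <= #|colors (layered_coloring n k) A|.+1 ^ 2.
Proof.
move=> n_le; set S := colors _ A; pose r := rank S.
have r_mono : {homo r : x y / x <= y} := @rank_mono _ S.
have f_lt (v : 'I_n) : compress r v < #|S|.+1 ^ 2.
  by apply: leq_trans (compress_lt _ r_mono) _; rewrite leq_exp2r // ltnS rank_le.
have f_mono : {in A &, forall u v : 'I_n, u < v -> compress r u < compress r v}.
  move=> u v uA vA uv; apply: compress_mono => // x.
  have c_gt0 := edge_color_gt0 uv.
  have c_lt : (edge_color u v).-1 < k.+1.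
    have := edge_color_le_layer u v; have := layer_bounds v.
    have := ltn_ord v; move: n_le; rewrite -!mulnn; nia.
  have cS : inord (edge_color u v).-1 \in S.
    rewrite -(layered_coloringE k uv); apply: imset_f.
    by rewrite inE cards2 neq_ltn uv subUset !sub1set uA vA.
  rewrite -(prednK c_gt0) ltnS => x_le.
  by have := @rank_jump _ S _ x cS; rewrite inordK //; apply.
pose f v := Ordinal (f_lt v).
rewrite -[_ ^ 2]card_ord -(card_in_imset (f := f)) ?max_card // => u v uA vA.
move/(congr1 val) => /= e.
apply/eqP; rewrite -[_ == _]negbK neq_ltn; apply/negP=> /orP[/f_mono|/f_mono].
  by move/(_ uA vA); rewrite e ltnn.
by move/(_ vA uA); rewrite e ltnn.
Qed.

Lemma gallai_arrow_gt k q p n : 0 < k -> q.+1 ^ 2 < p ->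
  gallai_arrow k q p n -> k.+1 ^ 2 < n.
Proof.
case: k => // k _ p_gt /andP[_ /forallP/(_ (layered_coloring n k))].
rewrite layered_gallai => /existsP[A /andP[/eqP cardA le_q]].
rewrite ltnNge; apply/negP=> /(layered_clique A); rewrite cardA.
by apply/negP; rewrite -ltnNge; apply: leq_ltn_trans p_gt; rewrite leq_exp2r.
Qed.

Theorem theorem1p9 (p k : nat) (hp : 17 <= p) (hk : Nat.sqrt (p - 1) - 1 <= k) :
  k ^ 2 + 2 * k + 2 <= gallai_ramsey k (Nat.sqrt (p - 1) - 1) p.
Proof.
have m_ge4 : 4 <= Nat.sqrt (p - 1) by apply: (@layer_mono 16); lia.
have := layer_bounds (p - 1); rewrite /layer => /andP[m_le _].
have [|arrow _] := @gallai_ramseyP k (Nat.sqrt (p - 1) - 1) p; first by lia.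
have : k.+1 ^ 2 < gallai_ramsey k (Nat.sqrt (p - 1) - 1) p.
  apply: gallai_arrow_gt arrow; first by lia.
  have -> : (Nat.sqrt (p - 1) - 1).+1 = Nat.sqrt (p - 1) by lia.
  by lia.
by rewrite -!mulnn; lia.
Qed.
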